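(* Let $F=\mathbb{F}_q$ be the finite field with $q$ elements and $P\in\mathbb{F}_q[t]$ a polynomial of degree $d\ge1$. Let $\mu$ be the Haar measure on $\hat K$ normalized so that $\mu(\mathcal{M})=1$, restricted to $\mathcal{M}$, and consider the generalized Schneider map $T_P:\mathcal{M}\to\mathcal{M}$. Then $\mu$ is ergodic under $T_P$, i.e. every measurable $X\subseteq\mathcal{M}$ with $T_P^{-1}(X)=X$ satisfies $\mu(X)\in\{0,1\}$.
   Context: Notation: $\hat K=\mathbb{F}_q(\!(t^{-1})\!)$, with valuation $\nu$ satisfying $\nu(f/g)=\deg(g)-\deg(f)$ on $\mathbb{F}_q(t)$; $\mathcal{M}=\{z\in\hat K:\nu(z)>0\}=t^{-1}\mathbb{F}_q[[t^{-1}]]$; $A_d=\{Q\in\mathbb{F}_q[t]:\deg Q<d\}$. Generalized Schneider map: for $z\in\hat K^\times$ there is a unique pair $(f,n)\in A_d\times\mathbb{Z}$ such that $\nu\left(\frac{P^n}{z}-f\right)>0$ and $\nu(1/z)=nd-\deg(f)$. Define $T_P(z)=\frac{P^n}{z}-f\in\mathcal{M}$. At the single point $z=0$ (of measure zero) set $T_P(0)=0$. Thus $T_P$ restricts to a map $\mathcal{M}\to\mathcal{M}$. *)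

(* Defs.v *)
From HB Require Import structures.
From mathcomp Require Import all_boot all_order all_algebra.
From mathcomp Require Import all_classical all_reals all_analysis.
From mathcomp Require Import zify ring.

Set Implicit Arguments.
Unset Strict Implicit.
Unset Printing Implicit Defensive.

Import Order.TTheory GRing.Theory Num.Theory.

Local Open Scope classical_set_scope.
Local Open Scope ring_scope.

(* Series are indexed by powers of t^-1: x n is the coefficient of t^(-n). *)
Record laurent (F : fieldType) := Laurent {
  lcoef :> int -> F ;
  lcoef_bounded : exists N : int, forall n, n < N -> lcoef n = 0 }.

HB.instance Definition _ (F : fieldType) := gen_eqMixin (laurent F).
HB.instance Definition _ (F : fieldType) := gen_choiceMixin (laurent F).

Lemma laurentP (F : fieldType) (x y : laurent F) : (forall n, x n = y n) -> x = y.
Proof.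
case: x => x hx; case: y => y hy /= /funext exy.
by rewrite {}exy in hx *; rewrite (Prop_irrelevance hx hy).
Qed.

Section LaurentRing.
Context {F : fieldType}.
Implicit Types x y z : laurent F.

Definition lbound (x : int -> F) (a : int) := forall n, n < a -> x n = 0.

Fact lzero_subproof : exists N : int, forall n, n < N -> (fun=> 0 : F) n = 0.
Proof. by exists 0. Qed.
Definition lzero : laurent F := Laurent lzero_subproof.

Fact lone_subproof :
  exists N : int, forall n, n < N -> (fun n : int => (n == 0)%:R : F) n = 0.
Proof. by exists 0 => n n0; rewrite lt_eqF. Qed.
Definition lone : laurent F := Laurent lone_subproof.

Fact lopp_subproof x : exists N : int, forall n, n < N -> (fun n => - x n) n = 0.
Proof. by case: (lcoef_bounded x) => N xN; exists N => n /xN ->; rewrite oppr0. Qed.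
Definition lopp x : laurent F := Laurent (lopp_subproof x).

Fact ladd_subproof x y :
  exists N : int, forall n, n < N -> (fun n => x n + y n) n = 0.
Proof.
case: (lcoef_bounded x) => N xN; case: (lcoef_bounded y) => M yM.
exists (Num.min N M) => n; rewrite lt_min => /andP[nN nM].
by rewrite xN // yM // addr0.
Qed.
Definition ladd x y : laurent F := Laurent (ladd_subproof x y).

(* The sum has finite support. *)
Definition lmul_coef (x y : int -> F) (n : int) : F :=
  \sum_(i \in [set: int]) x i * y (n - i).

Lemma lmul_coef_lt (x y : int -> F) a b n : lbound x a -> lbound y b ->
  n < a + b -> lmul_coef x y n = 0.
Proof.
move=> xa yb nab; apply: fsbig1 => i _.
case: (ltP i a) => ia; first by rewrite xa // mul0r.
by rewrite yb ?mulr0 //; lia.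
Qed.

Lemma fsbig_iota (f : int -> F) (h : nat -> int) (k : nat) : injective h ->
  (forall i, (forall j, (j < k)%N -> i != h j) -> f i = 0) ->
  \sum_(i \in [set: int]) f i = \sum_(j < k) f (h j).
Proof.
move=> hI f0; have e := @fsbigE _ 0 +%R int setT [seq h j | j <- iota 0 k] f.
rewrite e ?map_inj_uniq ?iota_uniq //.
- rewrite big_map -(big_mkord xpredT (fun j : nat => f (h j))).
  rewrite /index_iota subn0; apply: eq_bigl => j; exact: in_setT.
- move=> i _ hi; apply: f0 => j jk; apply: contraNneq hi => ->.
  by rewrite map_f // mem_iota.
Qed.

Lemma lmul_coefE (x y : int -> F) a b (k : nat) : lbound x a -> lbound y b ->
  lmul_coef x y (a + b + k%:Z) =
  \sum_(j < k.+1) x (a + j%:Z) * y (b + (k - j)%N%:Z).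
Proof.
move=> xa yb; rewrite /lmul_coef.
rewrite (@fsbig_iota _ (fun j => a + j%:Z) k.+1) => [|i j /addrI []//|i hi].
  by apply: eq_bigr => j _; congr (_ * y _); have := ltn_ord j; lia.
case: (ltP i a) => ia; first by rewrite xa // mul0r.
rewrite yb ?mulr0 // ltNge; apply/negP => h.
by have := hi `|i - a|%N; lia.
Qed.

Definition tpoly (x : int -> F) (a : int) (K : nat) : {poly F} :=
  \poly_(j < K.+1) x (a + j%:Z).

Lemma lmul_coef_poly (x y : int -> F) a b k K : lbound x a -> lbound y b ->
  (k <= K)%N ->
  lmul_coef x y (a + b + k%:Z) = (tpoly x a K * tpoly y b K)`_k.
Proof.
move=> xa yb kK; rewrite (lmul_coefE _ xa yb) coefM; apply: eq_bigr => j _.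
by rewrite !coef_poly !ifT //; have := ltn_ord j; lia.
Qed.

Fact lmul_subproof x y :
  exists N : int, forall n, n < N -> lmul_coef x y n = 0.
Proof.
case: (lcoef_bounded x) => N xN; case: (lcoef_bounded y) => M yM.
by exists (N + M) => n; apply: lmul_coef_lt.
Qed.
Definition lmul x y : laurent F := Laurent (lmul_subproof x y).

Lemma int_ge_ex (a n : int) : a <= n -> exists k : nat, n = a + k%:Z.
Proof. by move=> an; exists `|n - a|%N; lia. Qed.

Fact laddA : associative ladd.
Proof. by move=> x y z; apply: laurentP => n /=; rewrite addrA. Qed.
Fact laddC : commutative ladd.
Proof. by move=> x y; apply: laurentP => n /=; rewrite addrC. Qed.
Fact ladd0 : left_id lzero ladd.
Proof. by move=> x; apply: laurentP => n /=; rewrite add0r. Qed.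
Fact laddN : left_inverse lzero lopp ladd.
Proof. by move=> x; apply: laurentP => n /=; rewrite addNr. Qed.

Fact lmulC : commutative lmul.
Proof.
move=> x y; apply: laurentP => n /=.
case: (lcoef_bounded x) => a xa; case: (lcoef_bounded y) => b yb.
case: (ltP n (a + b)) => nab.
  by rewrite (lmul_coef_lt xa yb) // (lmul_coef_lt yb xa) // addrC.
case: (int_ge_ex nab) => k ->.
by rewrite (lmul_coef_poly xa yb (leqnn k)) (addrC a) (lmul_coef_poly yb xa (leqnn k)) mulrC.
Qed.

Fact lmulA : associative lmul.
Proof.
move=> x y z; apply: laurentP => n.
case: (lcoef_bounded x) => a xa; case: (lcoef_bounded y) => b yb.
case: (lcoef_bounded z) => c zc.
have xyab : lbound (lmul x y) (a + b) by move=> m; apply: lmul_coef_lt.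
have yzbc : lbound (lmul y z) (b + c) by move=> m; apply: lmul_coef_lt.
change (lmul_coef x (lmul y z) n = lmul_coef (lmul x y) z n).
case: (ltP n (a + b + c)) => nabc.
  by rewrite (lmul_coef_lt xa yzbc) ?addrA // (lmul_coef_lt xyab zc).
case: (int_ge_ex nabc) => k ->.
rewrite (lmul_coef_poly xyab zc (leqnn k)) -addrA.
rewrite addrA -(addrA a) (lmul_coef_poly xa yzbc (leqnn k)).
transitivity (tpoly x a k * (tpoly y b k * tpoly z c k))`_k.
  rewrite [LHS]coefM [RHS]coefM; apply: eq_bigr => j _; congr (_ * _).
  by rewrite coef_poly ifT ?ltnS ?leq_subr //= (@lmul_coef_poly _ _ b c _ k) // leq_subr.
rewrite mulrA [LHS]coefM [RHS]coefM; apply: eq_bigr => j _; congr (_ * _).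
by rewrite coef_poly ltn_ord /= (@lmul_coef_poly _ _ a b _ k) // -ltnS ltn_ord.
Qed.

Fact lmul1 : left_id lone lmul.
Proof.
move=> x; apply: laurentP => n /=.
case: (lcoef_bounded x) => a xa.
have l0 : lbound lone 0 by move=> m m0 /=; rewrite lt_eqF.
case: (ltP n (0 + a)) => na; first by rewrite (lmul_coef_lt l0 xa) // xa //; rewrite add0r in na.
case: (int_ge_ex na) => k ->.
rewrite (lmul_coefE _ l0 xa) big_ord_recl big1 /= ?addr0 ?add0r ?mul1r ?subn0 //.
by move=> i _; rewrite /= mul0r.
Qed.

Fact lmulDl : left_distributive lmul ladd.
Proof.
move=> x y z; apply: laurentP => n.
case: (lcoef_bounded x) => a xa; case: (lcoef_bounded y) => b yb.
case: (lcoef_bounded z) => c zc; pose m := Num.min a b.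
have xm : lbound x m by move=> i; rewrite lt_min => /andP[/xa].
have ym : lbound y m by move=> i; rewrite lt_min => /andP[_ /yb].
have xym : lbound (ladd x y) m by move=> i im /=; rewrite xm // ym // addr0.
change (lmul_coef (ladd x y) z n = lmul_coef x z n + lmul_coef y z n).
case: (ltP n (m + c)) => nm; first by rewrite !(@lmul_coef_lt _ _ m c) // addr0.
case: (int_ge_ex nm) => k ->; rewrite !(@lmul_coefE _ _ m c) // -big_split /=.
by apply: eq_bigr => i _; rewrite mulrDl.
Qed.

HB.instance Definition _ := GRing.isZmodule.Build (laurent F) laddA laddC ladd0 laddN.

Fact lone_neq0 : lone != 0.
Proof.
apply/eqP => /(congr1 (fun x : laurent F => x 0)) /= /eqP.
by rewrite oner_eq0.
Qed.

HB.instance Definition _ := GRing.Zmodule_isComNzRing.Build (laurent F)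
  lmulA lmulC lmul1 lmulDl lone_neq0.

Lemma lcoefD x y n : (x + y) n = x n + y n. Proof. by []. Qed.
Lemma lcoefN x n : (- x) n = - x n. Proof. by []. Qed.
Lemma lcoefB x y n : (x - y) n = x n - y n. Proof. by []. Qed.
Lemma lcoef0 n : (0 : laurent F) n = 0. Proof. by []. Qed.
Lemma lcoef1 n : (1 : laurent F) n = (n == 0)%:R. Proof. by []. Qed.
Lemma lcoefM x y n : (x * y) n = \sum_(i \in [set: int]) x i * y (n - i).
Proof. by []. Qed.

Definition is_ord x (n : int) := x n != 0 /\ lbound x n.

Lemma is_ord_ex x : x != 0 -> exists n, is_ord x n.
Proof.
move=> x0; case: (lcoef_bounded x) => a xa.
have ex : exists k : nat, x (a + k%:Z) != 0.
  apply: contrapT => h; move/eqP: x0; apply; apply: laurentP => n.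
  case: (ltP n a) => [/xa -> //|/int_ge_ex [k ->]].
  by apply: contrapT => /eqP xk; apply: h; exists k.
exists (a + (ex_minn ex)%:Z); case: ex_minnP => k xk kmin; split=> // n nak.
case: (ltP n a) => [/xa //|/int_ge_ex [j nE]]; rewrite nE in nak *.
by apply: contrapT => /eqP /kmin; lia.
Qed.

Lemma is_ord_uniq x m n : is_ord x m -> is_ord x n -> m = n.
Proof.
move=> [xm bm] [xn bn]; case: (ltgtP m n) => // [/bn|/bm] e.
- by rewrite e eqxx in xm.
- by rewrite e eqxx in xn.
Qed.

Lemma is_ord_neq0 x n : is_ord x n -> x != 0.
Proof. by case=> xn _; apply: contraNneq xn => ->. Qed.

Lemma is_ordM x y m n : is_ord x m -> is_ord y n -> is_ord (x * y) (m + n).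
Proof.
move=> [xm bm] [yn bn]; split; last by move=> i; apply: lmul_coef_lt.
rewrite -[m + n]addr0; change (lmul_coef x y (m + n + 0%N%:Z) != 0).
by rewrite (lmul_coefE _ bm bn) big_ord1 /= !addr0 mulf_neq0.
Qed.

Lemma is_ord1 : is_ord 1 0.
Proof. by split; [rewrite lcoef1 eqxx oner_eq0 | move=> n n0; rewrite lcoef1 lt_eqF]. Qed.

Fact laurent_inv_ex x : x != 0 -> exists y, y * x = 1.
Proof.
case/is_ord_ex => a [xa ba].
pose X (j : nat) := x (a + j%:Z).
pose nxt k (s : seq F) : F :=
  (X 0)^-1 * ((k == 0%N)%:R - \sum_(j < k) X j.+1 * s`_(k - j.+1)).
pose g := fix g k := if k is k'.+1 then rcons (g k') (nxt k' (g k')) else [::].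
have sg k : size (g k) = k by elim: k => //= k ih; rewrite size_rcons ih.
pose Y k := (g k.+1)`_k.
have gY k j : (j < k)%N -> (g k)`_j = Y j.
  elim: k => // k ih; rewrite ltnS leq_eqVlt => /predU1P[-> //|jk].
  by rewrite /= nth_rcons sg jk ih.
have YE k : \sum_(j < k.+1) X j * Y (k - j)%N = (k == 0%N)%:R.
  rewrite big_ord_recl /= subn0 {1}/Y /= nth_rcons sg ltnn eqxx {1}/nxt mulrA.
  rewrite divff ?mul1r; last by rewrite /X addr0.
  rewrite -addrA -[RHS]addr0; congr (_ + _); apply/eqP; rewrite addrC subr_eq0.
  by apply/eqP; apply: eq_bigr => j _; rewrite gY ?lift0 //; have := ltn_ord j; lia.
pose yc (n : int) := if n < - a then 0 else Y (absz (n + a)).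
have by_ : lbound yc (- a) by move=> n na; rewrite /yc na.
pose y := @Laurent F yc (ex_intro _ _ by_).
exists y; rewrite mulrC; apply: laurentP => n; rewrite lcoef1.
change (lmul_coef x yc n = (n == 0)%:R).
case: (ltP n (a - a)) => na.
  by rewrite (lmul_coef_lt ba by_) //; rewrite subrr in na; rewrite lt_eqF.
case: (int_ge_ex na) => k ->; rewrite (lmul_coefE _ ba by_) subrr add0r.
rewrite -[RHS]/((k == 0%N)%:R) -YE; apply: eq_bigr => j _; congr (_ * _).
by rewrite /yc ifF; [congr Y; lia | lia].
Qed.

Definition linv x : laurent F :=
  if x == 0 then 0 else xget 0 [set y | y * x = 1].

Fact lmulV x : x != 0 -> linv x * x = 1.
Proof.
move=> x0; rewrite /linv (negbTE x0).
exact: (xgetPex 0 (laurent_inv_ex x0)).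
Qed.

Fact linv0 : linv 0 = 0. Proof. by rewrite /linv eqxx. Qed.

HB.instance Definition _ := GRing.ComNzRing_isField.Build (laurent F) lmulV linv0.

Lemma is_ordV x n : is_ord x n -> is_ord x^-1 (- n).
Proof.
move=> xn; have x0 := is_ord_neq0 xn.
have [m xm] := is_ord_ex (invr_neq0 x0).
have := is_ordM xn xm; rewrite divff // => /(is_ord_uniq is_ord1) => e.
by have -> : - n = m by lia.
Qed.

Lemma is_ordX x n (k : int) : is_ord x n -> is_ord (x ^ k) (n * k).
Proof.
move=> xn; have pos (j : nat) : is_ord (x ^+ j) (n * j%:Z).
  elim: j => [|j ih]; first by rewrite mulr0; exact: is_ord1.
  by rewrite exprS (_ : n * j.+1%:Z = n + n * j%:Z); [exact: is_ordM | lia].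
case: k => j; first exact: pos.
by rewrite NegzE -exprnN mulrN; apply: is_ordV.
Qed.

End LaurentRing.

Section PolyEmbedding.
Context {F : fieldType}.

Fact lpoly_subproof (p : {poly F}) :
  exists N : int, forall n : int, n < N ->
    (fun n : int => if n <= 0 then p`_(absz n) else 0) n = 0.
Proof.
exists (- (size p)%:Z) => n hn; case: ifP => // _.
by rewrite nth_default //; move: (size p) hn => s hn; lia.
Qed.

Definition lpoly (p : {poly F}) : laurent F := Laurent (lpoly_subproof p).

Lemma lpolyE p (k : nat) : lpoly p (- k%:Z) = p`_k.
Proof. by rewrite /= ifT ?abszN //; lia. Qed.

Lemma lpoly_gt0 p (n : int) : 0 < n -> lpoly p n = 0.
Proof. by move=> n0 /=; rewrite ifF //; lia. Qed.

Lemma le0_ex (n : int) : n <= 0 -> exists k : nat, n = - k%:Z.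
Proof. by move=> n0; exists `|n|%N; lia. Qed.

Fact lpoly_is_zmod_morphism : zmod_morphism lpoly.
Proof.
move=> p q; apply: laurentP => n; rewrite lcoefB.
case: (ltP 0 n) => [n0|/le0_ex [k ->]]; first by rewrite !lpoly_gt0 // subr0.
by rewrite !lpolyE coefB.
Qed.

Fact lpoly_is_monoid_morphism : monoid_morphism lpoly.
Proof.
split.
  apply: laurentP => n; rewrite lcoef1.
  case: (ltP 0 n) => [n0|/le0_ex [k ->]]; first by rewrite lpoly_gt0 // gt_eqF.
  by rewrite lpolyE coef1 oppr_eq0.
move=> p q; apply: laurentP => n; rewrite lcoefM.
case: (ltP 0 n) => [n0|/le0_ex [k ->]].
  rewrite lpoly_gt0 // fsbig1 // => i _.
  case: (ltP 0 i) => i0; first by rewrite lpoly_gt0 // mul0r.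
  by rewrite [lpoly q _]lpoly_gt0 ?mulr0 //; lia.
rewrite lpolyE coefM.
rewrite (@fsbig_iota _ _ (fun j => - j%:Z) k.+1) => [|i j /oppr_inj []//|i hi].
  apply: eq_bigr => j _; rewrite lpolyE; congr (_ * _).
  by rewrite -lpolyE; congr (lpoly q _); have := ltn_ord j; lia.
case: (ltP 0 i) => i0; first by rewrite lpoly_gt0 // mul0r.
rewrite [lpoly q _]lpoly_gt0 ?mulr0 // ltNge; apply/negP => h.
by have := hi `|i|%N; lia.
Qed.

HB.instance Definition _ :=
  GRing.isZmodMorphism.Build {poly F} (laurent F) lpoly lpoly_is_zmod_morphism.
HB.instance Definition _ :=
  GRing.isMonoidMorphism.Build {poly F} (laurent F) lpoly lpoly_is_monoid_morphism.

Lemma is_ord_lpoly (p : {poly F}) : p != 0 -> is_ord (lpoly p) (- (size p).-1%:Z).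
Proof.
move=> p0; split; first by rewrite lpolyE -lead_coefE lead_coef_eq0.
move=> n hn; case: (ltP 0 n) => [/lpoly_gt0 //|/le0_ex [k nE]].
rewrite nE lpolyE nth_default //; move: p0 hn; rewrite -size_poly_gt0 nE.
by move: (size p) => s; lia.
Qed.

End PolyEmbedding.

Section Schneider.
Context {F : fieldType}.
Local Open Scope ereal_scope.

Definition deg (p : {poly F}) : \bar int :=
  if p == 0%R then -oo else ((size p).-1%:Z)%:E.

Definition nu (x : laurent F) : \bar int :=
  if x == 0%R then +oo
  else (xget 0%R [set n | x n != 0%R /\ forall m, (m < n)%R -> x m = 0%R])%:E.

Lemma nu_is_ord (x : laurent F) n : is_ord x n -> nu x = n%:E.
Proof.
move=> xn; rewrite /nu (negbTE (is_ord_neq0 xn)); congr (_%:E).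
exact: is_ord_uniq (xgetPex 0%R (ex_intro _ n xn)) xn.
Qed.

Lemma nu0 : nu 0%R = +oo. Proof. by rewrite /nu eqxx. Qed.

Lemma nu_lpoly (p : {poly F}) : nu (lpoly p) = - deg p.
Proof.
rewrite /deg; case: eqVneq => [->|p0]; first by rewrite raddf0 nu0.
by rewrite (nu_is_ord (is_ord_lpoly p0)).
Qed.

Lemma nu_frac (f g : {poly F}) : g != 0%R ->
  nu (lpoly f / lpoly g)%R = deg g - deg f.
Proof.
move=> g0; have og := is_ord_lpoly g0.
rewrite /deg (negbTE g0); case: eqVneq => [->|f0].
  by rewrite raddf0 mul0r nu0.
rewrite (nu_is_ord (is_ordM (is_ord_lpoly f0) (is_ordV og))) opprK.
by rewrite addrC.
Qed.

Lemma nu_gtP (x : laurent F) (n : int) :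
  n%:E < nu x <-> forall m, (m <= n)%R -> x m = 0%R.
Proof.
have [->|/is_ord_ex [k xk]] := eqVneq x 0%R.
  by rewrite nu0; split=> // _; exact: ltry.
rewrite (nu_is_ord xk) lte_fin; case: xk => xk bk; split=> [nk m mn|h].
  by apply: bk; exact: le_lt_trans nk.
by rewrite ltNge; apply/negP => /h e; rewrite e eqxx in xk.
Qed.

(* The pair (f, n) of A_d x Z attached to z, where d = deg P. *)
Definition schneider_pair (P : {poly F}) (z : laurent F) (fn : {poly F} * int) :=
  let: (f, n) := fn in
  [/\ deg f < deg P,
      0%:E < nu (lpoly P ^ n / z - lpoly f)%R
    & nu (1 / z)%R = (n * (size P).-1%:Z)%:E - deg f].

Lemma schneider_pair_exists_unique (P : {poly F}) (z : laurent F) :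
  (1 <= (size P).-1)%N -> z != 0%R -> exists! fn, schneider_pair P z fn.
Proof.
rewrite /schneider_pair => d_gt0 z0; have [v zv] := is_ord_ex z0.
have P0 : P != 0%R by apply: contraTneq d_gt0 => ->; rewrite size_poly0.
have wn (n : int) : is_ord (lpoly P ^ n / z)%R (- (size P).-1%:Z * n - v)%R.
  by apply: is_ordM; [apply: is_ordX; exact: is_ord_lpoly | exact: is_ordV].
rewrite mul1r (nu_is_ord (is_ordV zv)) /deg (negbTE P0).
move: (size P).-1 d_gt0 wn => d d_gt0 wn.
set n := (- (v %/ d%:Z)%Z)%R; set e := absz (v %% d%:Z)%Z.
have eE : (v + n * d%:Z)%R = e%:Z by rewrite /n /e; lia.
have ed : (e < d)%N by rewrite /e; lia.
set w := (lpoly P ^ n / z)%R.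
have we : is_ord w (- e%:Z)%R by rewrite -eE; have := wn n; congr is_ord; lia.
pose f : {poly F} := \poly_(i < e.+1) w (- i%:Z)%R.
have szf : size f = e.+1 by apply: size_poly_eq; case: we.
have f0 : f != 0%R by rewrite -size_poly_gt0 szf.
exists (f, n); split.
  rewrite (negbTE f0) szf /=; split.
  - by rewrite lte_fin; lia.
  - apply/nu_gtP => m m0; have [k ->] := le0_ex m0.
    rewrite lcoefB -/w lpolyE coef_poly; case: ltnP => ke; first by rewrite subrr.
    by rewrite subr0; case: we => _; apply; lia.
  - by congr (_%:E); lia.
move=> [f' n'] [].
have [_|f'0 fd' nuw' [vE]] := eqVneq f' 0%R; first by [].
have n'E : n' = n.
  by move: fd'; rewrite lte_fin /n; move: (size f').-1 vE => s vE; nia.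
rewrite n'E in vE nuw' *; congr pair; apply/polyP => i; rewrite coef_poly.
have wf j : w (- j%:Z)%R = f'`_j.
  apply/eqP; rewrite -subr_eq0 -lpolyE -lcoefB; apply/eqP.
  by move/nu_gtP: nuw'; apply; lia.
case: ltnP => [_|ei]; first exact: wf.
by rewrite -wf; case: we => _ ->//; lia.
Qed.

Definition schneider (P : {poly F}) (z : laurent F) : laurent F :=
  if z == 0%R then 0%R
  else let: (f, n) := xget (0%R, 0%R) (schneider_pair P z) in
       (lpoly P ^ n / z - lpoly f)%R.

Definition maxideal : set (laurent F) := [set z | 0%:E < nu z].

Lemma schneider_maxideal (P : {poly F}) (z : laurent F) :
  (1 <= (size P).-1)%N -> maxideal (schneider P z).
Proof.
move=> d_gt0; rewrite /schneider; case: eqVneq => [_|z0].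
  by rewrite /maxideal /= nu0; exact: ltry.
have [fn [Pfn _]] := schneider_pair_exists_unique d_gt0 z0.
by have := xgetPex (0%R, 0%R) (ex_intro _ fn Pfn); case: xget => f n [].
Qed.

End Schneider.

Section Topology.
Context {F : fieldType}.

HB.instance Definition _ := isPointed.Build (laurent F) (0 : laurent F).

Definition lopen : set_system (laurent F) :=
  [set A | forall x : laurent F, A x -> exists n : int,
     [set y : laurent F | (n%:E < nu (y - x)%R)%E] `<=` A].

Fact lopenT : lopen setT.
Proof. by move=> x _; exists 0. Qed.

Fact lopenI : setI_closed lopen.
Proof.
move=> A B oA oB x [/oA [m mA] /oB [n nB]]; exists (Num.max m n) => y /= h.
by split; [apply: mA | apply: nB] => /=; apply: le_lt_trans h;
  rewrite lee_fin le_max lexx ?orbT.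
Qed.

Fact lopen_bigU (I : Type) (f : I -> set (laurent F)) :
  (forall i, lopen (f i)) -> lopen (\bigcup_i f i).
Proof.
move=> fo x [i _ /(fo i) [n nf]]; exists n => y /nf fy.
by exists i.
Qed.

HB.instance Definition _ :=
  isOpenTopological.Build (laurent F) lopenT lopenI lopen_bigU.

End Topology.

Notation borelLaurent F := (g_sigma_algebraType (@open (laurent F))).

(* The regularity usually required of a Haar measure is automatic here: F being
   finite, laurent F is locally compact and second countable. *)
Definition is_haar (F : finFieldType) (R : realType)
    (mu : {measure set (borelLaurent F) -> \bar R}) : Prop :=
  [/\ forall (a : laurent F) (A : set (borelLaurent F)), measurable A ->
        mu [set a + x | x in (A : set (laurent F))] = mu A,
      forall C : set (laurent F), compact C -> (mu C < +oo)%E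
    & mu setT <> 0%E].

(* Main.v *)
Require Import Defs.
From HB Require Import structures.
From mathcomp Require Import all_boot all_order all_algebra.
From mathcomp Require Import all_classical all_reals all_analysis.
From mathcomp Require Import zify ring.

Import Order.TTheory GRing.Theory Num.Theory.
Local Open Scope classical_set_scope.
Local Open Scope ring_scope.

(* Near every z <> 0 the map T_P has a full branch: if nu(z) = v and e is the
   remainder of v modulo d, the pair (f, n) is constant on the ball
   [nu(y - z) > v + e], and since T_P y - T_P y' = P^n (y' - y) / (y y'), T_P is
   there a similarity of ratio q^(v + e) onto the whole maximal ideal M. An
   invariant X therefore satisfies mu(X /\ B) = mu(X) mu(B) on the domain B of
   every branch contained in M, hence, by induction on the radius, on every ball
   of M: a ball is either contained in the domain of a branch, which expands it,
   or, up to the null point 0, a union of such domains. So mu(X /\ A) =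
   mu(X) mu(A) for all Borel sets A of M, and A := X gives mu(X) = mu(X)^2. *)

(** * Balls in the field of Laurent series *)

Section Balls.
Context {F : fieldType}.
Implicit Types (x y z a : laurent F) (n k r : int).

(** The ball [nu (y - z) > n], encoded by agreement of coefficients, so that the ultrametric
    inequality becomes symmetry and transitivity of an equivalence. *)
Definition lball z n : set (laurent F) :=
  [set y | forall m : int, m <= n -> y m = z m].

Lemma lball_sym z y n : lball z n y -> lball y n z.
Proof. by move=> h m /h. Qed.

Lemma lball_trans y z x n : lball z n y -> lball y n x -> lball z n x.
Proof. by move=> zy yx m mn; rewrite yx // zy. Qed.

Lemma lball_eq z y n : lball z n y -> lball z n = lball y n.
Proof.
move=> h.
by apply/seteqP; split=> x; apply: lball_trans => //; apply: lball_sym.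
Qed.

Lemma le_lball z m n : m <= n -> lball z n `<=` lball z m.
Proof. by move=> mn y h i im; apply/h/(le_trans im). Qed.

Lemma lball0 : lball 0 0 = @maxideal F.
Proof.
apply/seteqP; split=> y /=.
  by move=> h; apply/nu_gtP => m /h.
by move=> /nu_gtP h m /h ->.
Qed.

Lemma lball_maxideal z : maxideal z -> lball z 0 = maxideal.
Proof. by rewrite -lball0 => /lball_eq ->. Qed.

Lemma lball_subl z y n : lball z n y <-> lball 0 n (y - z).
Proof.
split=> h m mn; first by rewrite lcoefB h // subrr.
by apply/eqP; rewrite -subr_eq0 -lcoefB h.
Qed.

Lemma lball_subset_maxideal z n :
  0 <= n -> maxideal z -> lball z n `<=` maxideal.
Proof. by move=> n0 zM; rewrite -(lball_maxideal z zM); apply: le_lball. Qed.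

Lemma lball0_mul n x v y :
  is_ord x v -> lball 0 (n + v) (x * y) <-> lball 0 n y.
Proof.
move=> xv; have x0 := is_ord_neq0 xv.
have mulb w u (t : laurent F) k :
    is_ord u w -> lball 0 k t -> lball 0 (k + w) (u * t).
  move=> [_ uw] tk m mk.
  (* The strict bound of [t] is [k + 1], so the product vanishes below [w + k + 1], that is, up to
     [k + w]. *)
  apply: (@lmul_coef_lt _ _ _ w (k + 1)) => //; last by lia.
  by move=> i ik; apply: tk; lia.
split; last exact: mulb.
move=> /(mulb _ _ _ _ (is_ordV xv)); rewrite mulKf //.
by rewrite addrK.
Qed.

Lemma is_ord_lball z y v n : is_ord z v -> v <= n -> lball z n y -> is_ord y v.
Proof.
move=> [zv zb] vn h; split; first by rewrite h.
by move=> i iv; rewrite h ?zb //; lia.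
Qed.

Lemma maxideal_ord z v : is_ord z v -> maxideal z <-> 0 < v.
Proof. by move=> zv; rewrite /maxideal /= (nu_is_ord zv) lte_fin. Qed.

End Balls.

(** * Full branches of the Schneider map *)

Section SchneiderBranch.
Context {F : fieldType} (P : {poly F}).
Context (d_gt0 : (1 <= (size P).-1)%N).
Implicit Types (x y z a : laurent F) (n k r : int).

Let P0 : P != 0.
Proof. by apply: contraTneq d_gt0 => ->; rewrite size_poly0. Qed.

Lemma schneiderE z f n : z != 0 -> schneider_pair P z (f, n) ->
  schneider P z = lpoly P ^ n / z - lpoly f.
Proof.
move=> z0 fn; rewrite /schneider (negbTE z0).
have [p [_ pu]] := schneider_pair_exists_unique d_gt0 z0.
have := xgetPex (0%R, 0%R) (ex_intro _ _ fn); case: xget => f' n' fn'.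
by have := pu (f', n') fn'; rewrite (pu (f, n) fn) => -[-> ->].
Qed.

(** With [v] the order of [z], [e = deg f] and [k = v + e], points of the ball keep the order [v]
    and the pair [(f, n)] of [z], so one formula describes the map there. *)
Lemma schneider_branch z : z != 0 ->
  exists k, [/\ ~ lball z k 0, maxideal z -> 0 < k,
    forall y y' r, lball z k y -> lball z k y' ->
      lball y (k + r) y' <-> lball (schneider P y) r (schneider P y')
  & forall a, maxideal a -> exists2 y, lball z k y & schneider P y = a].
Proof.
move=> z0; have [v zv] := is_ord_ex z0.
have [[f n] [fn _]] := schneider_pair_exists_unique d_gt0 z0.
have [fP fnu fnE] := fn.
(* Otherwise [nu (1 / z)] would be [+oo]. *)
have f0 : f != 0.
  apply/eqP => f0; move: fnE.
  by rewrite /deg f0 eqxx mul1r (nu_is_ord (is_ordV zv)).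
set e := (size f).-1; set d := (size P).-1 in fnE.
have vE : v = e%:Z - n * d%:Z.
  move: fnE; rewrite /deg (negbTE f0) mul1r (nu_is_ord (is_ordV zv)) => -[].
  by rewrite -/e; lia.
have ed : (e < d)%N.
  by move: fP; rewrite /deg (negbTE f0) (negbTE P0) lte_fin.
have oP := is_ordX n (is_ord_lpoly P0); rewrite -/d in oP.
have of_ := is_ord_lpoly f0; rewrite -/e in of_.
exists (v + e%:Z).
have nb : ~ lball z (v + e%:Z) 0.
  by move=> /(_ v) h; case: zv => + _; rewrite -h ?lcoef0 ?eqxx //; lia.
have ordb y : lball z (v + e%:Z) y -> is_ord y v.
  by apply: is_ord_lball => //; lia.
have diff y y' r : is_ord y v -> is_ord y' v ->
    lball y (v + e%:Z + r) y' <->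
    lball (lpoly P ^ n / y - lpoly f) r (lpoly P ^ n / y' - lpoly f).
  move=> yv yv'; have y0 := is_ord_neq0 yv; have y'0 := is_ord_neq0 yv'.
  rewrite [X in X <-> _]lball_subl [X in _ <-> X]lball_subl.
  have -> : lpoly P ^ n / y' - lpoly f - (lpoly P ^ n / y - lpoly f) =
            - (lpoly P ^ n * (y^-1 * y'^-1)) * (y' - y).
    by field; rewrite y0 y'0.
  (* The factor has order [- n d - 2 v], and [v = e - n d]. *)
  have o : is_ord (- (lpoly P ^ n * (y^-1 * y'^-1))) (- (v + e%:Z)).
    have -> : - (v + e%:Z) = - d%:Z * n + (- v + - v) by rewrite vE; lia.
    have := is_ordM oP (is_ordM (is_ordV yv) (is_ordV yv')) => -[nz lo].
    split; first by rewrite lcoefN oppr_eq0.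
    by move=> i /lo e0; rewrite lcoefN e0 oppr0.
  rewrite -(lball0_mul (v + e%:Z + r) _ _ _ o).
  by rewrite (_ : v + e%:Z + r - (v + e%:Z) = r) //; lia.
(* Taking [r = 0] in [diff] shows that [P^n / y - f] stays in the maximal ideal. *)
have pairb y : lball z (v + e%:Z) y -> schneider_pair P y (f, n).
  move=> zy; have yv := ordb y zy; split => //.
    have := diff z y 0 zv yv; rewrite addr0 => -[/(_ zy) + _].
    by rewrite lball_maxideal.
  rewrite mul1r (nu_is_ord (is_ordV yv)) -(nu_is_ord (is_ordV zv)).
  by rewrite -[z^-1]mul1r.
have bE y : lball z (v + e%:Z) y -> schneider P y = lpoly P ^ n / y - lpoly f.
  by move=> zy; apply: schneiderE (pairb _ zy); exact: is_ord_neq0 (ordb _ zy).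
split=> //.
- by rewrite (maxideal_ord _ _ zv); lia.
- by move=> y y' r zy zy'; rewrite !bE //; apply: diff; exact: ordb.
(* The inverse branch: [y] solves [P^n / y - f = a]. Adding [a] leaves the order [-e] of [f]
   unchanged, so [y] has order [v], and [diff] read backwards puts it in the ball. *)
- move=> a aM; pose y := lpoly P ^ n / (lpoly f + a).
  have ofa : is_ord (lpoly f + a) (- e%:Z).
    apply: (is_ord_lball (lpoly f) _ _ 0 of_); first by lia.
    by rewrite lball_subl addrC addKr lball0.
  have yv : is_ord y v.
    by have := is_ordM oP (is_ordV ofa); congr is_ord; rewrite vE; lia.
  have yE : lpoly P ^ n / y - lpoly f = a.
    rewrite /y; field.
    by rewrite (is_ord_neq0 ofa) (is_ord_neq0 oP).
  have zy : lball z (v + e%:Z) y.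
    rewrite -[v + _]addr0 diff // yE.
    by rewrite lball_maxideal.
  by exists y => //; rewrite bE.
Qed.

End SchneiderBranch.

(** * Borel sets, and measures compared on balls *)

Section BallMeasures.
Context {F : finFieldType} {R : realType}.
Implicit Types (x y z a : laurent F) (n k r : nat).

Lemma open_lballP (A : set (laurent F)) :
  open A <-> forall x, A x -> exists n : int, lball x n `<=` A.
Proof.
have nuE x (n : int) : [set y | (n%:E < nu (y - x)%R)%E] = lball x n.
  apply/seteqP; split=> y /=.
    by move=> /nu_gtP h; apply/lball_subl => m /h.
  by move=> /lball_subl h; apply/nu_gtP => m /h.
change (open A) with (lopen A).
by split=> h x /h[n nA]; exists n; rewrite ?nuE // -nuE.
Qed.

Lemma measurable_open (A : set (borelLaurent F)) :
  open (A : set (laurent F)) -> measurable A.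
Proof. exact: sub_sigma_algebra. Qed.

Lemma open_lball x (n : int) : open (lball x n).
Proof. by apply/open_lballP => y h; exists n; rewrite (lball_eq _ _ _ h). Qed.

Lemma measurable_lball x (n : int) :
  measurable (lball x n : set (borelLaurent F)).
Proof. by apply: measurable_open; exact: open_lball. Qed.

Lemma open_neq z : open [set x | x != z].
Proof.
apply/open_lballP => x /=; rewrite -subr_eq0 => /is_ord_ex[v [xv _]].
exists v => y h; apply/eqP => yz.
by move: xv; rewrite lcoefB -h // yz subrr eqxx.
Qed.

Lemma measurable_point z : measurable ([set z] : set (borelLaurent F)).
Proof.
rewrite (_ : [set z] = ~` [set x | x != z]); last first.
  apply/seteqP; split=> x /=; first by move=> ->; rewrite eqxx.
  by move/negP/negPn/eqP.
by apply: measurableC; apply: measurable_open; exact: open_neq.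
Qed.

Lemma measurable_maxideal : measurable (maxideal : set (borelLaurent F)).
Proof. by rewrite -lball0; exact: measurable_lball. Qed.

(** Inside the maximal ideal this word determines the ball of index [n] around [y]; balls are thus
    indexed by words over a finite alphabet, a countable type. *)
Definition digits y n : seq F := mkseq (fun i => y i.+1%:Z) n.

Lemma take_digits y n k : (k <= n)%N -> take k (digits y n) = digits y k.
Proof.
by move=> kn; rewrite /digits /mkseq -map_take take_iota (minn_idPl kn).
Qed.

Lemma lball_digits z n y : maxideal z ->
  lball z n y <-> maxideal y /\ digits y n = digits z n.
Proof.
rewrite -lball0 => zM; split=> [h|[yM yz] m mn].
  split; first by apply: (lball_trans z) => //; exact: le_lball h.
  by apply/eq_in_map => i; rewrite mem_iota => /andP[_ ni]; apply: h; lia.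
case: (leP m 0) => m0; first by rewrite yM // zM.
have [i iE] : exists i, m = i.+1%:Z by exists `|m - 1|%N; lia.
have := congr1 (nth 0 ^~ i) yz; rewrite !nth_mkseq ?iE //; lia.
Qed.

(* The maximal balls contained in [O] on which the measures agree are pairwise
   disjoint, countably many, and cover [O]. *)
Lemma measure_eq_cover (m1 m2 : {measure set (borelLaurent F) -> \bar R})
    (O : set (borelLaurent F)) : O `<=` maxideal ->
  (forall z, O z -> exists n,
     lball z n `<=` O /\ m1 (lball z n) = m2 (lball z n)) ->
  m1 O = m2 O.
Proof.
move=> OM cover.
pose cyl (s : seq F) : set (borelLaurent F) :=
  [set y | maxideal y /\ digits y (size s) = s].
have cylE z n : maxideal z -> cyl (digits z n) = lball z n.
  move=> zM; apply/seteqP; split=> y; rewrite /cyl /= size_mkseq.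
    by move=> h; apply/(lball_digits _ _ _ zM).
  by move=> /(lball_digits _ _ _ zM).
pose good s := cyl s `<=` O /\ m1 (cyl s) = m2 (cyl s).
(* Codes of the good words without a good proper prefix, that is, of the maximal good balls. *)
pose D := [set i | exists s : seq F, [/\ pickle s = i, cyl s !=set0, good s
   & forall j, (j < size s)%N -> ~ good (take j s)]].
pose C i := cyl (odflt [::] (pickle_inv i)).
have CE s : C (pickle s) = cyl s by rewrite /C pickleK_inv.
have mC i : D i -> measurable (C i).
  case=> s [<- [y [yM <-]] _ _]; rewrite CE cylE //; exact: measurable_lball.
have OE : O = \bigcup_(i in D) C i.
  apply/seteqP; split=> [z Oz|y [_ [s [<- _ [sO _] _]]]]; last first.
    by rewrite CE => /sO.
  (* The shortest good prefix of the digits of [z] names the maximal good ball around [z]. *)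
  have ex : exists n, `[< good (digits z n) >].
    have [n h] := cover z Oz; exists n; apply/asboolP.
    by rewrite /good cylE //; exact: OM.
  have [n /asboolP gn nmin] := find_ex_minn ex.
  exists (pickle (digits z n)); last first.
    by rewrite CE; split; [exact: OM | rewrite size_mkseq].
  exists (digits z n); split=> //.
    by exists z; split; [exact: OM | rewrite size_mkseq].
  move=> j; rewrite size_mkseq => jn; rewrite take_digits ?(ltnW jn) //.
  by move=> /asboolP /nmin; lia.
have tC : trivIset D C.
  (* Words of balls sharing [y] are both prefixes of the digits of [y]; minimality excludes
     different lengths. *)
  move=> _ _ [s [<- _ gs smin]] [s' [<- _ gs' s'min]].
  rewrite !CE => -[y [[_ ys] [_ ys']]]; congr pickle.
  case: (ltngtP (size s) (size s')) => ss.
  - by case: (s'min _ ss); rewrite -ys' take_digits ?(ltnW ss) // ys.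
  - by case: (smin _ ss); rewrite -ys take_digits ?(ltnW ss) // ys'.
  - by rewrite -ys ss ys'.
rewrite OE !measure_bigcup //; apply: eq_eseriesr => i.
by rewrite inE => -[s [<- _ [_ +] _]]; rewrite CE.
Qed.

(** Open subsets of the maximal ideal are covered by balls inside them, so the restricted measures
    agree on open sets. These are stable under intersection and generate the Borel sets, and
    finiteness yields uniqueness. *)
Lemma measure_eq_lball (m1 m2 : {measure set (borelLaurent F) -> \bar R}) :
  (m1 maxideal < +oo)%E ->
  (forall z n, maxideal z -> m1 (lball z n) = m2 (lball z n)) ->
  forall A : set (borelLaurent F), measurable A -> A `<=` maxideal ->
  m1 A = m2 A.
Proof.
move=> fin mm A mA AM.
have mM := measurable_maxideal.
suff : mrestr m1 mM A = mrestr m2 mM A by rewrite /mrestr (setIidl AM).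
apply: (@measure_unique _ _ (borelLaurent F) (@open (laurent F))
  (fun=> setT)) => //.
- by move=> ? ?; exact: openI.
- by move=> _; exact: openT.
- by rewrite bigcup_const.
- move=> O oO; apply: (measure_eq_cover m1 m2 (O `&` maxideal)).
    exact: subIsetr.
  move=> z [Oz zM].
  have : open (O `&` maxideal).
    by apply: openI => //; rewrite -lball0; exact: open_lball.
  move=> /open_lballP /(_ z (conj Oz zM)) [n nO]; exists `|n|%N; split.
    by apply: subset_trans nO; apply: le_lball; lia.
  exact: mm.
- by move=> _; rewrite [X in (X < _)%E]/= /mrestr setTI.
Qed.

End BallMeasures.

(** * Haar measure of balls and of the origin *)

Section HaarBalls.
Context {F : finFieldType} {R : realType}.
Context (mu : {measure set (borelLaurent F) -> \bar R}).
Context (mu_haar : is_haar mu) (mu_norm : mu maxideal = 1%E).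
Implicit Types (x y z a : laurent F) (n k r : nat).

Let q : R := #|F|%:R.

Let q_gt0 : 0 < q.
Proof. by rewrite ltr0n; apply/card_gt0P; exists 0. Qed.

Lemma haar_lty (A : set (borelLaurent F)) :
  measurable A -> A `<=` maxideal -> (mu A < +oo)%E.
Proof.
move=> mA AM; apply: (@le_lt_trans _ _ (mu maxideal)).
  by apply: le_measure; rewrite ?inE //; exact: measurable_maxideal.
by rewrite mu_norm ltry.
Qed.

Lemma haar_mass (A : set (borelLaurent F)) :
  measurable A -> A `<=` maxideal -> exists2 c : R, 0 <= c & mu A = c%:E.
Proof.
move=> mA AM; exists (fine (mu A)); first exact: fine_ge0.
by rewrite fineK // ge0_fin_numE //; exact: haar_lty.
Qed.

Lemma haar_lball_shift z (n : int) : mu (lball z n) = mu (lball 0 n).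
Proof.
have [+ _ _] := mu_haar => /(_ z _ (measurable_lball 0 n)) <-; congr (mu _).
apply/seteqP; split=> [y zy|_ [y y0 <-]].
  exists ((y : laurent F) - z); last exact: subrKC.
  exact: (lball_subl z y n).1.
by apply: (lball_subl _ _ _).2; rewrite addrC addKr.
Qed.

(** The ball splits into [q] disjoint translates of the next smaller one, by the series [b t^-(n+1)]
    with [b] in [F]. *)
Lemma haar_lballS n : mu (lball 0 n) = (q%:E * mu (lball 0%R n.+1))%E.
Proof.
have cb (b : F) : exists N : int, forall m, m < N ->
    (if m == n.+1%:Z then b else 0) = 0.
  by exists 0 => m m0; rewrite ifN //; lia.
pose c b := Laurent (cb b).
have -> : lball 0 n =
    \bigcup_(b in [set: F]) (lball (c b) n.+1 : set (borelLaurent F)).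
  apply/seteqP; split=> [y h|y [b _ h] m mn].
    exists (y n.+1%:Z) => // m mn /=.
    by case: eqP => [->//|/eqP mn']; rewrite h //; lia.
  by rewrite h /=; [rewrite ifN //; lia | lia].
rewrite measure_fin_bigcup //; last by move=> b _; exact: measurable_lball.
- rewrite (eq_fsbigr (fun=> mu (lball 0 n.+1))); last first.
    by move=> b _; exact: haar_lball_shift.
  rewrite (_ : [set: F] = [set` enum F]); last first.
    by apply/seteqP; split=> b //= _; rewrite mem_enum.
  rewrite -fsbig_seq ?enum_uniq // big_enum /= sumr_const mule_natl.
  by congr (_ *+ _); apply: eq_card.
- exact: finite_finset.
- move=> b b' _ _ [y [/(_ n.+1%:Z (lexx _)) + /(_ n.+1%:Z (lexx _))]].
  by rewrite /= eqxx => -> .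
Qed.

Lemma haar_lball z n : mu (lball z n) = (q ^- n)%:E.
Proof.
rewrite haar_lball_shift; elim: n => [|n ih].
  by rewrite lball0 expr0 invr1.
have := haar_lballS n; rewrite ih.
(* An infinite value would make [q ^- n] infinite. *)
case: (mu (lball 0 n.+1)) => [x||]; last 2 first.
- by rewrite gt0_muley ?lte_fin.
- by rewrite gt0_muleNy ?lte_fin.
move=> [qx]; congr (_%:E).
by rewrite exprS invfM qx mulKf // gt_eqF.
Qed.

Lemma haar_point : mu [set 0] = 0%E.
Proof.
have le1 n : (mu [set 0%R] <= (q ^- n)%:E)%E.
  rewrite -(haar_lball 0); apply: le_measure; rewrite ?inE.
  - exact: measurable_point.
  - exact: measurable_lball.
  - by move=> _ ->.
have : (0 <= mu [set 0%R])%E by [].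
case: (mu _) le1 => [x||] le1 //; last by have := le1 0%N.
rewrite lee_fin => x0; congr (_%:E); apply/eqP; rewrite eq_le x0 andbT leNgt.
(* Choose [n > 1 / x]; then [q ^ n > n] gives [q ^- n < x], a contradiction. *)
apply/negP => x_gt0; have := archi_boundP (ltW (_ : 0 < x^-1)).
rewrite invr_gt0 => /(_ x_gt0); set n := Num.bound _ => xn.
have := le1 n; rewrite lee_fin leNgt => /negP; apply.
rewrite -[x]invrK ltf_pV2 ?posrE ?exprn_gt0 ?invr_gt0 //.
apply: (lt_le_trans xn); rewrite /q -natrX ler_nat; apply/ltnW/ltn_expl.
exact: card_finNzRing_gt1.
Qed.

Lemma haarD0 (A : set (borelLaurent F)) :
  measurable A -> mu A = mu (A `\ (0 : laurent F)).
Proof.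
move=> mA; have m0 := @measurable_point F 0.
rewrite (measureDI mu mA m0).
rewrite [X in (_ + X)%E](subset_measure0 _ m0 _ haar_point) ?adde0 //.
exact: measurableI.
Qed.

End HaarBalls.

(** * Action of the Schneider map on measure, and invariant sets *)

Section SchneiderMeasure.
Context {F : finFieldType} (P : {poly F}) {R : realType}.
Context (d_gt0 : (1 <= (size P).-1)%N).
Context (mu : {measure set (borelLaurent F) -> \bar R}).
Context (mu_haar : is_haar mu) (mu_norm : mu maxideal = 1%E).
Implicit Types (x y z a : laurent F) (n k r : nat).

Let q : R := #|F|%:R.
Let T : borelLaurent F -> borelLaurent F := schneider P.

(** The map is continuous off [0], so the preimage of an open set is an open set, possibly with the
    point [0] added. *)
Lemma measurable_schneider : measurable_fun [set: borelLaurent F] T.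
Proof.
apply: (@measurability _ _ (borelLaurent F) (borelLaurent F) setT T
  (@open (laurent F)) erefl) => _ [U oU <-].
rewrite setTI (_ : T @^-1` U =
    (T @^-1` U `&` [set x | x != 0]) `|` (T @^-1` U `&` [set 0])); last first.
  rewrite -setIUr (_ : _ `|` _ = setT) ?setIT //.
  apply/seteqP; split=> x // _ /=.
  by have [->|] := eqVneq (x : laurent F) 0; [right | left].
apply: measurableU.
  apply: measurable_open; apply/open_lballP => x [Ux x0].
  have [n nU] := (open_lballP U).1 oU _ Ux.
  have [k [nz _ sim _]] := schneider_branch P d_gt0 x x0.
  (* The ball must lie in the branch and map into the ball of index [n], where [n] may be
     negative. *)
  exists (Num.max k (k + n)) => y xy; split.
    apply: nU; apply/(sim x y n _ _).1 => //.
      by apply: le_lball xy; rewrite le_max lexx.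
    by apply: le_lball xy; rewrite le_max lexx orbT.
  apply/eqP => y0; apply: nz; rewrite -y0.
  by apply: le_lball xy; rewrite le_max lexx.
have [U0|U0] := pselect (U (T 0)).
  rewrite setIC setIidl; first exact: measurable_point.
  by move=> _ ->.
rewrite (_ : _ `&` _ = set0) //; apply/seteqP; split=> x //= [Ux x0].
by apply: U0; rewrite -x0.
Qed.

(** The full branch in terms of sets: mass is scaled by [q ^- k] under pullback, and the similarity
    turns into an identity between balls. *)
Definition branch_ball z k := [/\ (0 < k)%N, ~ lball z k 0,
    forall A : set (borelLaurent F), measurable A -> A `<=` maxideal ->
      mu (lball z k `&` T @^-1` A) = ((q ^- k)%:E * mu A)%E &
    forall r, lball z (k + r)%N = lball z k `&` T @^-1` lball (T z) r].

Lemma branch_ball_ex z : z != 0 -> maxideal z -> exists k, branch_ball z k.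
Proof.
move=> z0 zM; have [k [nz k_gt0 sim surj]] := schneider_branch P d_gt0 z z0.
have {}k_gt0 := k_gt0 zM.
have kE : k = `|k|%N%:Z by lia.
have pre y r : lball z k y ->
    lball z k `&` T @^-1` lball (T y) r = lball y (`|k| + r)%N.
  move=> zy; apply/seteqP; split=> [x [zx]|x yx].
    by move=> /(sim _ _ _ zy zx); rewrite kE.
  have zx : lball z k x.
    by apply: (lball_trans y) => //; apply: le_lball yx; lia.
  by split=> //; apply/(sim _ _ _ zy zx); rewrite kE.
exists `|k|%N; rewrite /branch_ball -kE; split=> //; first by lia.
  have qk : 0 <= q ^- `|k| by rewrite invr_ge0 exprn_ge0.
  (* The pushforward of [mu] restricted to the branch ball, to be compared with [q ^- k] times [mu]
     on balls. *)
  pose m1 := measure_function_pushforward__canonical__measure_function_Measure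
    (mrestr mu (measurable_lball z k)) measurable_schneider.
  have mE A : m1 A = mu (lball z k `&` T @^-1` A).
    by rewrite /m1 /= /pushforward /mrestr setIC.
  move=> A mA AM; rewrite -mE.
  apply: (measure_eq_lball m1 (mscale (NngNum qk) mu)) => //.
    rewrite mE; apply: (haar_lty mu mu_norm); last first.
      by move=> x [zx _]; apply: lball_subset_maxideal zM _ zx; lia.
    apply: measurableI; first exact: measurable_lball.
    rewrite -[X in measurable X]setTI; apply: measurable_schneider => //.
    exact: measurable_maxideal.
  (* Surjectivity of the branch gives [T y = a], so the ball around [a] pulls back to the ball of
     index [k + r] around [y]. *)
  move=> a r aM; rewrite mE; have [y zy <-] := surj a aM.
  rewrite pre // haar_lball // exprD invfM EFinM.
  by rewrite -(haar_lball mu mu_haar mu_norm (T y) r).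
by move=> r; rewrite pre.
Qed.

Lemma schneider_invariant_lball (X : set (borelLaurent F)) : measurable X ->
  X `<=` maxideal -> maxideal `&` T @^-1` X = X ->
  forall n z, maxideal z -> mu (X `&` lball z n) = (mu X * mu (lball z n))%E.
Proof.
move=> mX XM TX.
have mM := @measurable_maxideal F.
have [c c0 cE] := haar_mass mu mu_norm X mX XM.
(* Invariance allows [X] to be moved under the preimage. *)
have XT z n (B : set (borelLaurent F)) : maxideal z ->
    X `&` (lball z n `&` T @^-1` B) = lball z n `&` T @^-1` (X `&` B).
  move=> zM; rewrite -[in LHS]TX; apply/seteqP; split=> x /=.
    by move=> [[_ Tx] [zx Bx]].
  move=> [zx [Tx Bx]]; split=> //; split=> //.
  exact: lball_subset_maxideal zx.
elim/ltn_ind => n ih z zM.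
(* If the ball lies in a branch ball, the branch expands it to index [n - k < n], where the
   induction hypothesis applies. *)
have [[y [k [zy kn [k0 nz sc br]]]]|] := pselect (exists y k,
  [/\ lball z n y, (k <= n)%N & branch_ball y k]).
  have TyM : maxideal (T y) by exact: schneider_maxideal.
  have yM : maxideal y by apply: lball_subset_maxideal zy.
  rewrite (lball_eq _ _ _ zy).
  have -> : n = (k + (n - k))%N by lia.
  rewrite br XT // !sc //.
  - by rewrite ih //; [exact: muleCA | lia].
  - exact: measurable_lball.
  - exact: lball_subset_maxideal.
  - by apply: measurableI => //; exact: measurable_lball.
  - by move=> x [/XM].
move=> far.
have mB := @measurable_lball F z n.
(* Otherwise every branch ball meeting the ball at its centre is smaller than it. The origin, which
   lies in no branch ball, is removed as a null point so that these balls cover the rest. *)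
rewrite (haarD0 _ mu_haar mu_norm _ (measurableI _ _ mX mB))
  (haarD0 _ mu_haar mu_norm _ mB) -setIDA setIC cE.
apply: (measure_eq_cover (mrestr mu mX) (mscale (NngNum c0) mu)
  (lball z n `\ 0)).
  by move=> y [zy _]; apply: lball_subset_maxideal zy.
move=> y [zy /eqP y0].
have yM : maxideal y by apply: lball_subset_maxideal zy.
have [k kb] := branch_ball_ex y y0 yM.
have nk : (n < k)%N.
  by rewrite ltnNge; apply/negP => kn; apply: far; exists y, k.
have [k0 nz sc br] := kb.
exists k; split.
  move=> x yx; split; last by move=> x0; apply: nz; rewrite -x0.
  by apply: (lball_trans y) => //; apply: le_lball yx; lia.
have TyM : maxideal (T y) by exact: schneider_maxideal.
(* With [r = 0] the branch ball is the pullback of the whole maximal ideal, of mass 1; both sides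
   then equal [q ^- k] times [mu X]. *)
have E := br 0%N; rewrite addn0 lball_maxideal // in E.
have XE : lball y k `&` X = lball y k `&` T @^-1` X.
  by have := XT y k setT yM; rewrite preimage_setT !setIT setIC.
transitivity (mu (lball y k `&` X)) => //; rewrite XE sc //.
transitivity (c%:E * mu (lball y k))%E => //.
by rewrite E sc // -cE mu_norm mule1 muleC.
Qed.

End SchneiderMeasure.

(** * Ergodicity, from independence of an invariant set from itself *)

Theorem theorem4p4 (F : finFieldType) (P : {poly F}) (d : nat)
    (hd : (1 <= d)%N) (hP : deg P = (d%:Z)%:E)
    (R : realType) (mu : {measure set (borelLaurent F) -> \bar R})
    (mu_haar : is_haar mu) (mu_norm : mu maxideal = 1%E) :
  forall X : set (borelLaurent F), measurable X -> X `<=` maxideal ->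
    maxideal `&` schneider P @^-1` X = X ->
    mu X = 0%E \/ mu X = 1%E.
Proof.
move=> X mX XM TX.
have d_gt0 : (1 <= (size P).-1)%N.
  by move: hP; rewrite /deg; case: eqP => // _ [] ->.
have [c c0 cE] := haar_mass mu mu_norm X mX XM.
have : mu X = (mu X * mu X)%E.
  transitivity (mrestr mu mX X); first by rewrite /mrestr setIid.
  transitivity (mscale (NngNum c0) mu X); last by rewrite {1}cE.
  apply: (measure_eq_lball (mrestr mu mX) (mscale (NngNum c0) mu)) => //.
    by rewrite /= /mrestr setIC (setIidl XM) cE ltry.
  move=> z n zM; transitivity (mu (X `&` lball z n)); first by rewrite setIC.
  by rewrite (schneider_invariant_lball P d_gt0 mu mu_haar mu_norm X) // cE.
rewrite cE -EFinM => -[] /eqP.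
rewrite -subr_eq0 -[X in X - _]mulr1 -mulrBr mulf_eq0 subr_eq0.
by case/orP => /eqP => [|<-]; [left|right] => //; congr (_%:E).
Qed.
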